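(* Assume that $\pi_k=\Pr(x_i\in\mathcal C_k)$ satisfies $0<\pi_{\min}\le \pi_k\le \pi_{\max}<1$ for $k=1,\dots,K$, and that $x_i\mid x_i\in\mathcal C_k\sim \mathcal N(\mu_k,\Sigma_W)$ for all $k=1,\dots,K$ with $\mu=\sum_{k=1}^K\pi_k\mu_k=0$. Then all elements of $X$ are sub-gaussian, that is $$\mathbb E e^{\lambda x_{ij}}\le e^{\lambda^2\tau^2/2}\quad\text{for all }\lambda\in\mathbb R;\quad i=1,\dots,n;\quad j=1,\dots,p;$$ where $\tau=\max_{j=1,\dots,p}\sqrt{\sigma_j^2+\max_k\mu_{kj}^2}$ with $\sigma_j^2$ being the diagonal elements of $\Sigma_W$. Similarly, all elements of $X\Sigma_T^{-1/2}$ are sub-gaussian with parameter $C>0$ that does not depend on $\Sigma_W$ or $\mu_k$.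
   Context: There are $K\ge2$ classes $\mathcal C_1,\dots,\mathcal C_K$; $(x_i,z_i)$, $i=1,\dots,n$, are independent (identically distributed) pairs where $x_i\in\mathbb R^p$ is a feature vector and $z_i\in\{0,1\}^K$ indicates the class of sample $i$ (each sample belongs to exactly one class; $x_i\in\mathcal C_k$ means sample $i$ belongs to class $k$). $X\in\mathbb R^{n\times p}$ has rows $x_i^\top$ and entries $x_{ij}$. $\Sigma_W=\mathrm{Cov}(x_i\mid x_i\in\mathcal C_k)$ is the common within-class covariance, $\Sigma_T=\mathrm{Cov}(x_i)$ is the marginal covariance, $\mu_k=\mathbb E(x_i\mid x_i\in\mathcal C_k)$ with $j$th coordinate $\mu_{kj}$. A random variable $t$ is sub-gaussian with parameter $C$ if $\mathbb E e^{\lambda t}\le e^{\lambda^2C^2/2}$ for all $\lambda\in\mathbb R$. *)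

(* Defs.v *)
From HB Require Import structures.
From mathcomp Require Import all_boot all_order all_algebra.
From mathcomp Require Import all_classical all_reals all_analysis.

Set Implicit Arguments.
Unset Strict Implicit.
Unset Printing Implicit Defensive.

Import Order.TTheory GRing.Theory Num.Theory.
Import numFieldNormedType.Exports.

Local Open Scope classical_set_scope.
Local Open Scope ring_scope.

Section Probability.
Context (d : measure_display) (T : measurableType d) (R : realType).
Variable P : probability T R.

(* 'M_P t is the moment generating function lam |-> E exp (lam t). *)
Definition subgaussian (t : T -> R) (C : R) : Prop :=
  forall lam : R, ('M_P t lam <= (expR (lam ^+ 2 * C ^+ 2 / 2))%:E)%E.

Definition mutually_independent (d' : measure_display)
    (T' : measurableType d') (I : finType) (Y : I -> T -> T') : Prop :=
  forall (J : {set I}) (A : I -> set T'),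
    (forall i, i \in J -> measurable (A i)) ->
    P (\bigcap_(i in [set` J]) (Y i @^-1` A i))
      = (\prod_(i in J) P (Y i @^-1` A i))%E.

Definition identically_distributed (d' : measure_display)
    (T' : measurableType d') (I : Type) (Y : I -> T -> T') : Prop :=
  forall (i i' : I) (A : set T'), measurable A ->
    P (Y i @^-1` A) = P (Y i' @^-1` A).

Definition cond_prob (A E : set T) : \bar R := (P (A `&` E) / P E)%E.

Definition cond_distribution (T' : Type) (Y : T -> T') (E : set T)
    (A : set T') : \bar R :=
  cond_prob (Y @^-1` A) E.

Definition cov_mx (p : nat) (Y : T -> p.-tuple R) : 'M[R]_p :=
  \matrix_(j, l) fine (covariance P (fun w => tnth (Y w) j)
                                    (fun w => tnth (Y w) l)).

End Probability.

(* N(m, v), parameterized by the variance v >= 0.  The degenerate case is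
   separated because [normal_prob m 0] is not the Dirac mass at m. *)
Definition normal_law (R : realType) (m v : R) (A : set R) : \bar R :=
  if v == 0 then (\d_m A)%E else normal_prob m (Num.sqrt v) A.

Definition psd_mx (R : realType) (p : nat) (A : 'M[R]_p) : Prop :=
  A^T = A /\ forall a : 'rV[R]_p, 0 <= (a *m A *m a^T) 0 0.

(* nu is the (possibly degenerate) normal law N(mu, Sigma) on R^p: the image
   of nu under every linear form a is N(a . mu, a Sigma a^T). *)
Definition is_multinormal (R : realType) (p : nat)
    (nu : set (p.-tuple R) -> \bar R) (mu : 'rV[R]_p) (Sigma : 'M[R]_p)
    : Prop :=
  psd_mx Sigma /\
  forall (a : 'rV[R]_p) (A : set R), measurable A ->
    nu [set v : p.-tuple R | A (\sum_(j < p) a 0 j * tnth v j)]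
      = normal_law (\sum_(j < p) a 0 j * mu 0 j) ((a *m Sigma *m a^T) 0 0) A.

(* S = A^(-1/2).  The unit condition matters: [invmx A] is A itself when A is
   singular. *)
Definition is_inv_sqrtmx (R : realType) (p : nat) (A S : 'M[R]_p) : Prop :=
  [/\ A \in unitmx, psd_mx S & S *m S = invmx A].

Definition data_mx (R : realType) (T : Type) (n p : nat)
    (x : 'I_n -> T -> p.-tuple R) (w : T) : 'M[R]_(n, p) :=
  \matrix_(i, j) tnth (x i w) j.

(* The event that the sample with class indicator vector z is in class k. *)
Definition in_class (T : Type) (K : nat) (z : T -> K.-tuple bool) (k : 'I_K)
    : set T :=
  [set w | tnth (z w) k].

(* Main.v *)
Require Import Defs.
From HB Require Import structures.
From mathcomp Require Import all_boot all_order all_algebra.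
From mathcomp Require Import all_classical all_reals all_analysis.
From mathcomp Require Import measurable_realfun ring lra.

Set Implicit Arguments.
Unset Strict Implicit.
Unset Printing Implicit Defensive.

Import Order.TTheory GRing.Theory Num.Theory.
Import numFieldNormedType.Exports.

Local Open Scope classical_set_scope.
Local Open Scope ring_scope.

(** Let [a] be a vector and [Y] the linear form with coefficients [a] of one
    sample. Given class [k], [Y] is normal with mean [m_k] and a variance [v]
    that is the same in all classes, so its moment generating function at [l]
    is [exp (l^2 v / 2)] times [\sum_k pi_k exp (l m_k)]. The second factor is
    the moment generating function of a centred variable taking finitely many
    values; Hoeffding's lemma bounds it by [exp (l^2 B / 2)] as soon as
    [m_k^2 <= B] for all [k]. Hence [Y] is sub-gaussian with parameter
    [sqrt (v + B)] ([subgaussian_mixture]). The coordinate forms give the bound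
    on the entries of [X].

    For the entries of [X Sigma_T^(-1/2)] the vector [a] is a row of
    [Sigma_T^(-1/2)], so that [Y] has variance [a Sigma_T a^T = 1]. The law of
    total variance ([total_variance]) reads [\sum_k pi_k (m_k^2 + v) = 1], and
    as every term is nonnegative and [pi_k >= pi_min], it forces
    [m_k^2 + v <= 1 / pi_min] for every [k]. The previous bound then holds with
    [B = 1 / pi_min - v], which makes the parameter [1 / sqrt pi_min], whatever
    the means and the covariance are.

    The moments come from exponentials only. A sub-gaussian variable is square
    integrable, and it is centred because [1 + l E X <= exp (l^2 C^2 / 2)] for
    all [l] compares a line with a curve that is tangent to the constant 1 at
    [l = 0] ([subgaussian_expectation0]). This gives the mean of a normal
    variable and that of [Y]. The variance of a normal variable follows in the
    same way from the explicit values of [E exp (- t (x - m)^2)]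
    ([normal_law_variance]). *)

(** * Hoeffding's lemma for finitely many values *)

Lemma ge_f0_of_derive_ge0 (R : realType) (f df : R -> R) :
  (forall y : R, is_derive (y : R^o) 1 f (df y)) ->
  (forall y, 0 <= y -> 0 <= df y) ->
  forall x, 0 <= x -> f 0 <= f x.
Proof.
move=> fE df0 x x0.
have dfE y : derivable (f : R^o -> R^o) y 1.
  exact: (@ex_derive _ _ _ _ _ _ _ (fE y)).
apply: (@ger0_derive1_ndecry _ f 0) => //.
- move=> y; rewrite in_itv/= andbT => y0.
  by rewrite derive1E (@derive_val _ _ _ _ _ _ _ (fE y)) df0// ltW.
- by apply: derivable_within_continuous => y _.
Qed.

Lemma sinh_le_mul_cosh (R : realType) (x : R) : 0 <= x ->
  expR x - expR (- x) <= x * (expR x + expR (- x)).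
Proof.
move=> x0.
pose f (y : R) := y * (expR y + expR (- y)) - (expR y - expR (- y)).
pose df (y : R) := y * (expR y - expR (- y)).
have fE (y : R) : is_derive (y : R^o) 1 f (df y).
  rewrite /f /df; apply: is_derive_eq.
  by rewrite /GRing.scale/=; ring.
rewrite -subr_ge0 -/(f x).
have -> : 0 = f 0 by rewrite /f mul0r oppr0 subrr subr0.
apply: ge_f0_of_derive_ge0 fE _ _ x0 => y y0.
by rewrite mulr_ge0// subr_ge0 ler_expR; lra.
Qed.

(** The function [cosh y * exp (- y^2 / 2)] has derivative
    [(sinh y - y * cosh y) * exp (- y^2 / 2)], so it is nonincreasing for
    [y >= 0]. *)
Lemma cosh_le_expR_sqr (R : realType) (x : R) :
  (expR x + expR (- x)) / 2 <= expR (x ^+ 2 / 2).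
Proof.
wlog x0 : x / 0 <= x => [H|].
  have [|/ltW x0] := leP 0 x; first exact: H.
  have := H (- x); rewrite opprK sqrrN addrC; apply.
  by rewrite oppr_ge0.
pose f (y : R) := - ((expR y + expR (- y)) * expR (- (y ^+ 2 / 2))).
pose df (y : R) :=
  (y * (expR y + expR (- y)) - (expR y - expR (- y))) * expR (- (y ^+ 2 / 2)).
have fE (y : R) : is_derive (y : R^o) 1 f (df y).
  rewrite /f /df; apply: is_derive_eq.
  by rewrite /GRing.scale/=; field.
have : f 0 <= f x.
  apply: ge_f0_of_derive_ge0 fE _ _ x0 => y y0.
  by rewrite mulr_ge0 ?expR_ge0// subr_ge0 sinh_le_mul_cosh.
rewrite /f oppr0 expr0n mul0r oppr0 expR0 mulr1 lerN2.
rewrite [expR (- (x ^+ 2 / 2))]expRN ler_pdivrMr ?expR_gt0// => h.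
by rewrite ler_pdivrMr// mulrC.
Qed.

Lemma expR_convex2 (R : realType) (p q a b : R) : 0 <= p -> 0 <= q -> p + q = 1 ->
  expR (p * a + q * b) <= p * expR a + q * expR b.
Proof.
move=> p0 q0 pq.
have tangent x y : expR x * (1 + (y - x)) <= expR y.
  by rewrite -[in leRHS](subrKC x y) expRD ler_pM2l ?expR_gt0// expR_ge1Dx.
set x := p * a + q * b.
have -> : expR x = p * (expR x * (1 + (a - x))) + q * (expR x * (1 + (b - x))).
  transitivity (expR x * (p + q + (x - (p + q) * x))); last by rewrite /x; ring.
  by rewrite pq; ring.
by apply: lerD; apply: ler_wpM2l => //; exact: tangent.
Qed.

Lemma sqr_bound_ge0 (R : realType) (K : nat) (w m : 'I_K -> R) (B : R) :
  \sum_(k < K) w k = 1 -> (forall k, m k ^+ 2 <= B) -> 0 <= B.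
Proof.
move=> w1 mB; have [k _|noK] := pickP (fun k : 'I_K => true).
  exact: le_trans (sqr_ge0 _) (mB k).
by move: w1; rewrite big1 => [/esym/eqP|k]; [rewrite oner_eq0|have := noK k].
Qed.

Lemma hoeffding_mgf (R : realType) (K : nat) (w m : 'I_K -> R) (B l : R) :
  (forall k, 0 <= w k) -> \sum_(k < K) w k = 1 ->
  \sum_(k < K) w k * m k = 0 -> (forall k, m k ^+ 2 <= B) ->
  \sum_(k < K) w k * expR (l * m k) <= expR (l ^+ 2 * B / 2).
Proof.
move=> w0 w1 m0 mB.
have [M0|M0] := leP B 0.
  have mk k : m k = 0.
    by apply/eqP; rewrite -sqrf_eq0 -[_ == _]andbT eq_le sqr_ge0 (le_trans (mB k)).
  have B0 : 0 <= l ^+ 2 * B / 2.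
    by rewrite divr_ge0// mulr_ge0 ?sqr_ge0// (sqr_bound_ge0 w1 mB).
  under eq_bigr do rewrite mk mulr0 expR0 mulr1.
  by rewrite w1 -[leLHS]expR0 ler_expR.
(* On [-M, M] the exponential lies below its chord, and averaging the chord
   against centred weights gives cosh (l * M). *)
pose M := Num.sqrt B; have Mp : 0 < M by rewrite sqrtr_gt0.
have MM : M ^+ 2 = B by rewrite sqr_sqrtr// ltW.
have mM k : - M <= m k <= M.
  by rewrite -ler_norml -ler_sqr ?nnegrE ?(ltW Mp)// real_normK ?num_real// MM.
apply: (@le_trans _ _ ((expR (l * M) + expR (- (l * M))) / 2)); last first.
  by apply: le_trans (cosh_le_expR_sqr _) _; rewrite exprMn MM.
have -> : (expR (l * M) + expR (- (l * M))) / 2 =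
  \sum_(k < K) w k * ((1 + m k / M) / 2 * expR (l * M)
                       + (1 - m k / M) / 2 * expR (- (l * M))).
  under eq_bigr => k _.
    rewrite (_ : _ * _ = w k * ((expR (l * M) + expR (- (l * M))) / 2)
       + w k * m k * ((expR (l * M) - expR (- (l * M))) / (2 * M))); last first.
      by field; rewrite gt_eqF.
    over.
  by rewrite big_split/= -!mulr_suml w1 m0 mul0r addr0 mul1r.
apply: ler_sum => k _; apply: ler_wpM2l => //.
have /andP[mk1 mk2] := mM k.
have r1 : m k / M <= 1 by rewrite ler_pdivrMr// mul1r.
have r2 : -1 <= m k / M by rewrite ler_pdivlMr// mulN1r.
rewrite (_ : l * m k = (1 + m k / M) / 2 * (l * M) + (1 - m k / M) / 2 * - (l * M)).
  by apply: expR_convex2; lra.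
by field; rewrite gt_eqF.
Qed.

(** * Moments of sub-gaussian variables *)

(** At [l = 0] the right-hand side is 1 with zero derivative, so the slope [e]
    vanishes. The proof evaluates at [l = e / (1 + 2 c + e^2)], which is small
    enough for [exp y <= 1 / (1 - y)] to contradict [e <> 0]. *)
Lemma eq0_of_tangent_le_expR (R : realType) (e c : R) : 0 <= c ->
  (forall l, 1 + l * e <= expR (l ^+ 2 * c)) -> e = 0.
Proof.
move=> c0 H; apply/eqP/negPn/negP => e0.
have e2 : 0 < e ^+ 2 by rewrite exprn_even_gt0.
pose k := 1 + 2 * c + e ^+ 2; have k0 : 0 < k by rewrite /k; lra.
have := H (e / k); set y := _ * c => Hy.
have y0 := expR_ge1Dx (- y).
have : (1 + e / k * e) * (1 - y) <= 1.
  have [y1|y1] := leP (1 - y) 0.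
    apply: le_trans ler01; rewrite mulr_ge0_le0//.
    by rewrite mulrAC -expr2 addr_ge0// divr_ge0// ltW.
  rewrite -[leRHS](expRxMexpNx_1 y) ler_pM// ?(ltW y1)//.
  by rewrite mulrAC -expr2 addr_ge0// divr_ge0// ltW.
have -> : y = (e ^+ 2 * c) / k ^+ 2 by rewrite /y; field; rewrite gt_eqF.
have -> : e / k * e = e ^+ 2 / k by rewrite mulrAC.
rewrite -(ler_pM2r (exprn_gt0 3 k0)) => h.
have : (k + e ^+ 2) * (k ^+ 2 - e ^+ 2 * c) <= k ^+ 3.
  by move: h; rewrite mul1r; congr (_ <= _); field; rewrite gt_eqF.
apply/negP; rewrite -ltNge /k; set u := e ^+ 2 in e2 *; nra.
Qed.

Section subgaussian.
Context (d : measure_display) (T : measurableType d) (R : realType).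
Variables (P : probability T R) (X : T -> R) (C : R).
Hypotheses (mX : measurable_fun setT X) (sX : subgaussian P X C).

Lemma subgaussian_integral_expR (l : R) :
  (\int[P]_w (expR (l * X w))%:E <= (expR (l ^+ 2 * C ^+ 2 / 2))%:E)%E.
Proof.
have := sX l; rewrite /mmt_gen_fun unlock; congr (_ <= _)%E.
by apply: eq_integral => w _ /=; rewrite mulrC.
Qed.

(** The square is dominated by exponentials: [X^2 <= 2 (exp X + exp (- X))]. *)
Lemma subgaussian_Lfun2 : X \in Lfun P 2%:E.
Proof.
rewrite inE; apply/andP; split; rewrite inE//=.
rewrite /finite_norm unlock /Lnorm poweR_lty//.
have mE (l : R) : measurable_fun [set: T] (fun w => (expR (l * X w))%:E).
  by apply/measurable_EFinP; apply: measurableT_comp => //; exact: measurable_funM.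
have -> : (\int[P]_w (`|(EFin \o X) w| `^ 2) = \int[P]_w ((X w) ^+ 2)%:E)%E.
  by apply: eq_integral => w _ /=; rewrite powR_mulrn// real_normK ?num_real.
apply: (@le_lt_trans _ _
  (\int[P]_w (2%:E * ((expR (1 * X w))%:E + (expR (-1 * X w))%:E)))%E).
  apply: ge0_le_integral => //.
  - by move=> w _; rewrite lee_fin sqr_ge0.
  - by apply/measurable_EFinP; exact: measurable_funX.
  - apply: emeasurable_funM => //; exact: emeasurable_funD.
  - move=> w _; rewrite -EFinD -EFinM lee_fin mul1r mulN1r.
    have sqr_le (y : R) : 0 <= y -> y ^+ 2 <= 2 * expR y.
      by move=> y0; have := expR_ge1Dxn 1 y0; rewrite (_ : (2`!)%N = 2%N)//; lra.
    have := expR_ge0 (X w); have := expR_ge0 (- X w).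
    have [/sqr_le|/ltW] := leP 0 (X w); first by lra.
    by rewrite -oppr_ge0 => /sqr_le; rewrite sqrrN; lra.
rewrite ge0_integralZl_EFin//; last 2 first.
- by move=> w _; rewrite -EFinD lee_fin addr_ge0 ?expR_ge0.
- exact: emeasurable_funD.
rewrite ge0_integralD//.
rewrite lte_mul_pinfty// lte_add_pinfty//.
- by apply: le_lt_trans (subgaussian_integral_expR _) _; rewrite ltry.
- by apply: le_lt_trans (subgaussian_integral_expR _) _; rewrite ltry.
Qed.

(** Integrating [1 + l X <= exp (l X)] gives a line through 1 at [l = 0] that
    stays below [exp (l^2 C^2 / 2)]. *)
Lemma subgaussian_expectation0 : ('E_P[X] = 0)%E.
Proof.
have X1 : X \in Lfun P 1.
  by apply: Lfun_subset12 subgaussian_Lfun2; exact: fin_num_measure.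
have fE := expectation_fin_num X1.
rewrite -(fineK fE); congr (_%:E).
apply: (@eq0_of_tangent_le_expR _ _ (C ^+ 2 / 2)) => [|l].
  by rewrite mulr_ge0 ?sqr_ge0.
have mE : measurable_fun [set: T] (fun w => (expR (l * X w))%:E).
  by apply/measurable_EFinP; apply: measurableT_comp => //; exact: measurable_funM.
have iE : P.-integrable setT (fun w => (expR (l * X w))%:E).
  apply/integrableP; split => //.
  under eq_integral do rewrite gee0_abs ?lee_fin ?expR_ge0//.
  by apply: le_lt_trans (subgaussian_integral_expR _) _; rewrite ltry.
rewrite mulrA -lee_fin; apply: le_trans (subgaussian_integral_expR _).
rewrite EFinD EFinM fineK// -expectationZl//.
rewrite -(expectation_cst P 1) -expectationD ?Lfun_cst ?Lfun_scale// unlock.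
apply: le_integral => //.
  apply/Lfun1_integrable; rewrite rpredD ?Lfun_cst ?Lfun_scale//.
by move=> w _; rewrite lee_fin /= mulrC expR_ge1Dx.
Qed.

End subgaussian.

Lemma subgaussian_le (d : measure_display) (T : measurableType d) (R : realType)
  (P : probability T R) (X : T -> R) (C1 C2 : R) :
  0 <= C1 <= C2 -> subgaussian P X C1 -> subgaussian P X C2.
Proof.
move=> /andP[C10 C12] sX l; apply: (le_trans (sX l)).
rewrite lee_fin ler_expR ler_pM2r// ler_wpM2l ?sqr_ge0//.
by rewrite ler_sqr ?nnegrE// (le_trans C10).
Qed.

(** * Exponential and quadratic moments of normal laws *)

(** The normal density is almost everywhere the Radon-Nikodym derivative of the
    normal law. *)
Lemma ge0_integral_normal_prob (R : realType) (m s : R) (f : R -> \bar R) :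
  measurable_fun setT f -> (forall x, 0 <= f x)%E ->
  (\int[normal_prob m s]_x f x =
   \int[lebesgue_measure]_x (f x * (normal_pdf m s x)%:E))%E.
Proof.
move=> mf f0.
have dom := normal_prob_dominates m s.
rewrite -(Radon_Nikodym_SigmaFinite.change_of_variables dom f0)//.
have ifR := Radon_Nikodym_SigmaFinite.f_integrable dom.
apply: ae_eq_integral => //.
- by apply: emeasurable_funM => //; exact: measurable_int ifR.
- apply: emeasurable_funM => //.
  by apply/measurable_EFinP; exact: measurable_normal_pdf.
- apply: ae_eqe_mul2l; apply: integral_ae_eq => //.
  + by apply/measurable_EFinP; exact: measurable_normal_pdf.
  + move=> E _ mE.
    by rewrite -(Radon_Nikodym_SigmaFinite.f_integral dom).
Qed.

(** If multiplying a normal density by [f] gives a multiple of another normal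
    density, the multiple is the integral of [f]. Completing the square provides
    such factorizations. *)
Lemma normal_prob_tilt (R : realType) (m s m' s' k : R) (f : R -> R) :
  measurable_fun setT f -> (forall x, 0 <= f x) -> 0 <= k ->
  (forall x, f x * normal_pdf m s x = k * normal_pdf m' s' x) ->
  (\int[normal_prob m s]_x (f x)%:E = k%:E)%E.
Proof.
move=> mf f0 k0 fE.
rewrite ge0_integral_normal_prob//; last exact/measurable_EFinP.
under eq_integral do rewrite -EFinM fE EFinM.
rewrite ge0_integralZl_EFin//.
- by rewrite integral_normal_pdf mule1.
- by move=> x _; rewrite lee_fin normal_pdf_ge0.
- by apply/measurable_EFinP; exact: measurable_normal_pdf.
Qed.

Lemma integral_normal_prob_expR (R : realType) (m s l : R) : s != 0 ->
  (\int[normal_prob m s]_x (expR (l * x))%:E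
   = (expR (l * m + l ^+ 2 * s ^+ 2 / 2))%:E)%E.
Proof.
move=> s0; apply: (@normal_prob_tilt _ _ _ (m + l * s ^+ 2) s (expR _)) => //.
- by apply: measurableT_comp => //; exact: measurable_funM.
- move=> x; rewrite !normal_pdfE// mulrCA [RHS]mulrCA /normal_fun -!expRD.
  by congr (_ * expR _); field.
Qed.

(** The factor turns the normal density with deviation [s] into the one with
    deviation [s / c]. The integrand grows at infinity for [c < 1], but
    the integral still converges; values of [c] on both sides of 1 are
    what determines the variance. *)
Lemma integral_normal_prob_gauss (R : realType) (m s c : R) : s != 0 -> 0 < c ->
  (\int[normal_prob m s]_x
     (expR (- ((c ^+ 2 - 1) / (2 * s ^+ 2) * (x - m) ^+ 2)))%:E = c^-1%:E)%E.
Proof.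
move=> s0 c0; have cn0 : c != 0 by rewrite gt_eqF.
apply: (@normal_prob_tilt _ _ _ m (s / c) c^-1) => //.
- apply: measurableT_comp => //; apply: measurableT_comp => //.
  apply: measurable_funM => //; apply: measurable_funX.
  exact: measurable_funB.
- by rewrite invr_ge0 ltW.
- move=> x; rewrite !normal_pdfE ?mulf_neq0 ?invr_neq0//.
  have -> : normal_peak (s / c) = c * normal_peak s.
    rewrite /normal_peak; have -> : (s / c) ^+ 2 * pi *+ 2 = c^-1 ^+ 2 * (s ^+ 2 * pi *+ 2).
      by rewrite exprMn -mulrnAr; ring.
    by rewrite sqrtrM ?sqr_ge0// sqrtr_sqr ger0_norm ?invr_ge0 1?ltW// invfM invrK.
  rewrite /normal_fun -[c * _ * _]mulrA mulKf// mulrCA -expRD.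
  by congr (_ * expR _); field; rewrite cn0.
Qed.

(** The same set function as [normal_law], as a probability measure that can be
    integrated against. *)
Definition normal_law_prob (R : realType) (m v : R) :
    probability (measurableTypeR R) R :=
  if v == 0 then (\d_(m : measurableTypeR R) : probability (measurableTypeR R) R)
  else normal_prob m (Num.sqrt v).

Lemma normal_law_probE (R : realType) (m v : R) (A : set R) :
  normal_law m v A = normal_law_prob m v A.
Proof. by rewrite /normal_law /normal_law_prob; case: ifP. Qed.

Lemma integral_normal_law_expR (R : realType) (m v l : R) : 0 <= v ->
  (\int[normal_law_prob m v]_x (expR (l * x))%:E
   = (expR (l * m + l ^+ 2 * v / 2))%:E)%E.
Proof.
move=> v0; rewrite /normal_law_prob; case: eqVneq => [->|vn0].
  rewrite integral_dirac//=; last first.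
    by apply/measurable_EFinP; apply: measurableT_comp => //; exact: measurable_funM.
  by rewrite diracT mul1e mulr0 mul0r addr0.
rewrite integral_normal_prob_expR ?sqr_sqrtr//.
by rewrite sqrtr_eq0 -ltNge lt_def vn0.
Qed.

(** Both sides equal 1 at [c = 1], where they have derivatives [- r] and [-1];
    since the inequality holds on both sides of [c = 1], these agree. *)
Lemma eq1_of_gauss_tangent (R : realType) (r : R) :
  (forall c, 0 < c -> 1 - (c ^+ 2 - 1) / 2 * r <= c^-1) -> r = 1.
Proof.
move=> H.
have {}H c : 0 < c -> (c - 1) * (2 - c * (c + 1) * r) <= 0.
  move=> c0; have := H c c0; rewrite -(ler_pM2l c0) mulfV ?gt_eqF// => h.
  have -> : (c - 1) * (2 - c * (c + 1) * r) = 2 * (c * (1 - (c ^+ 2 - 1) / 2 * r) - 1) by field.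
  by lra.
apply/eqP; rewrite eq_le; apply/andP; split; rewrite leNgt; apply/negP => r1.
(* If r > 1, the inequality fails at c = (1 + 1 / r) / 2 < 1. *)
- pose w := r^-1; have rE : r = w^-1 by rewrite /w invrK.
  have w0 : 0 < w by rewrite invr_gt0; lra.
  have w1 : w < 1 by rewrite invf_lt1//; lra.
  have := H ((1 + w) / 2) ltac:(lra).
  have -> : ((1 + w) / 2 - 1) * (2 - (1 + w) / 2 * ((1 + w) / 2 + 1) * r)
      = (1 - w) ^+ 2 * (3 - w) / 8 / w by rewrite rE; field; rewrite gt_eqF.
  by apply/negP; rewrite -ltNge !divr_gt0// mulr_gt0 ?exprn_gt0//; lra.
(* If r < 1, it fails at c = 1 + (1 - r) / 4. *)
- pose a := (1 - r) / 4; have rE : r = 1 - 4 * a by rewrite /a; field.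
  have a0 : 0 < a by rewrite /a; lra.
  have := H (1 + a) ltac:(lra).
  have -> : (1 + a - 1) * (2 - (1 + a) * (1 + a + 1) * r)
     = a ^+ 2 * (5 + 11 * a + 4 * a ^+ 2) by rewrite rE; ring.
  by apply/negP; rewrite -ltNge mulr_gt0 ?exprn_gt0// addr_gt0 ?mulr_gt0 ?exprn_gt0//; lra.
Qed.

Section normal_law_moments.
Context (R : realType) (m v : R) (v0 : 0 <= v).
Let N := normal_law_prob m v.
Let X (t : measurableTypeR R) : R := t - m.

Let mX : measurable_fun setT X.
Proof. exact: measurable_funB. Qed.

Lemma subgaussian_normal_law : subgaussian N X (Num.sqrt v).
Proof.
move=> l; rewrite /mmt_gen_fun unlock.
have -> : (\int[N]_t ((expR \o l \o* X) t)%:E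
    = \int[N]_t ((expR (- (l * m)))%:E * (expR (l * t))%:E))%E.
  apply: eq_integral => t _; rewrite /= -EFinM -expRD.
  by congr (expR _)%:E; rewrite /X; ring.
rewrite ge0_integralZl_EFin ?expR_ge0//; last first.
  by apply/measurable_EFinP; apply: measurableT_comp => //; exact: measurable_funM.
rewrite integral_normal_law_expR// -EFinM -expRD sqr_sqrtr//.
by rewrite addKr.
Qed.

(** Integrating [exp (- t) >= 1 - t] with [t] proportional to [(x - m)^2] bounds
    the variance through the integrals of [integral_normal_prob_gauss], from
    below for [c > 1] and from above for [c < 1]. *)
Lemma normal_law_variance : ('E_N[X ^+ 2] = v%:E)%E.
Proof.
have X2 := subgaussian_Lfun2 mX subgaussian_normal_law.
have XX1 := Lfun2_mul_Lfun1 X2 X2.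
have fE : ('E_N[X ^+ 2] \is a fin_num)%E by exact: expectation_fin_num.
have [vE|vn0] := eqVneq v 0.
  rewrite unlock /N /normal_law_prob vE eqxx integral_dirac//=; last first.
    by apply/measurable_EFinP; exact: (measurable_funX 2 mX).
  by rewrite diracT mul1e; congr (_%:E); rewrite -[LHS]/((m - m) ^+ 2) subrr expr0n.
have vp : 0 < v by rewrite lt_def vn0.
rewrite -(fineK fE); congr (_%:E); set q := fine _.
suff : q / v = 1 by move/divr1_eq.
apply: eq1_of_gauss_tangent => c c0.
have sn0 : Num.sqrt v != 0 by rewrite sqrtr_eq0 -ltNge.
have gE : (\int[N]_t (expR (- ((c ^+ 2 - 1) / (2 * v) * X t ^+ 2)))%:E = c^-1%:E)%E.
  rewrite -(integral_normal_prob_gauss m sn0 c0) sqr_sqrtr//.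
  by rewrite /N /normal_law_prob (negbTE vn0).
rewrite -lee_fin -gE.
have -> : ((1 - (c ^+ 2 - 1) / 2 * (q / v))%:E
    = 'E_N[(cst 1 \+ (- ((c ^+ 2 - 1) / (2 * v))) \o* (X ^+ 2))%R])%E.
  rewrite expectationD ?Lfun_cst ?Lfun_scale// expectationZl// expectation_cst.
  by rewrite -(fineK fE) -/q -EFinM -EFinD; congr (_%:E); field; rewrite gt_eqF.
have mXX := measurable_funX 2 mX.
rewrite unlock; apply: le_integral => //.
- by apply/Lfun1_integrable; rewrite rpredD ?Lfun_cst ?Lfun_scale.
- apply/integrableP; split.
    apply/measurable_EFinP; apply: measurableT_comp => //.
    by apply: measurableT_comp => //; exact: measurable_funM.
  under eq_integral do rewrite gee0_abs ?lee_fin ?expR_ge0//.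
  by rewrite gE ltry.
- move=> t _; rewrite lee_fin /=; apply: le_trans (expR_ge1Dx _).
  by rewrite le_eqVlt; apply/orP; left; apply/eqP; rewrite fctE mulrC mulNr.
Qed.

Lemma integral_normal_law_sqr : (\int[N]_t (t ^+ 2)%:E = (m ^+ 2 + v)%:E)%E.
Proof.
have X2 := subgaussian_Lfun2 mX subgaussian_normal_law.
have X1 : X \in Lfun N 1 by apply: Lfun_subset12 X2; exact: fin_num_measure.
have XX1 : X ^+ 2 \in Lfun N 1 := Lfun2_mul_Lfun1 X2 X2.
transitivity ('E_N[((X ^+ 2 \+ (2 * m) \o* X) \+ cst (m ^+ 2))%R])%E.
  by rewrite unlock; apply: eq_integral => t _ /=; congr _%:E; rewrite /X !fctE; ring.
rewrite !expectationD ?rpredD ?Lfun_cst ?Lfun_scale//.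
rewrite expectationZl// expectation_cst normal_law_variance.
rewrite (subgaussian_expectation0 mX subgaussian_normal_law).
by rewrite mule0 adde0 -EFinD addrC.
Qed.
End normal_law_moments.

(** * Mixtures *)

Section mixture.
Context (d d' : measure_display) (T : measurableType d) (T' : measurableType d').
Context (R : realType) (K : nat) (P : probability T R) (Y : T -> T').
Context (E : 'I_K -> set T) (w : 'I_K -> R) (nu : 'I_K -> probability T' R).
Hypotheses (mY : measurable_fun setT Y) (mE : forall k, measurable (E k)).
Hypothesis (partE : forall t, exists! k, E k t).
Hypotheses (w0 : forall k, 0 <= w k).
Hypothesis law : forall k A, measurable A ->
  P (Y @^-1` A `&` E k) = ((w k)%:E * nu k A)%E.

(** The law of [Y] is the sum of the measures [w k * nu k]. *)
Lemma ge0_integral_mixture (f : T' -> \bar R) :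
  measurable_fun setT f -> (forall y, 0 <= f y)%E ->
  (\int[P]_t f (Y t) = \sum_(k < K) (w k)%:E * \int[nu k]_y f y)%E.
Proof.
move=> mf f0.
(* Finite sums of measures are indexed by initial segments of nat. *)
pose m_ (n : nat) : {measure set T' -> \bar R} :=
  if insub n is Some k then mscale (NngNum (w0 k)) (nu k) else mzero.
have m_E (k : 'I_K) : m_ k = mscale (NngNum (w0 k)) (nu k) by rewrite /m_ valK.
transitivity (\int[pushforward P Y]_y f y)%E.
  by rewrite ge0_integral_pushforward.
rewrite (eq_measure_integral (msum m_ K)); last first.
  move=> A mA _; rewrite /msum.
  have mYA : measurable (Y @^-1` A) by rewrite -[_ @^-1` _]setTI; exact: mY.
  have YAE : Y @^-1` A = \big[setU/set0]_(k < K) (Y @^-1` A `&` E k).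
    rewrite -bigcup_seq; apply/seteqP; split => [t At|t [k _ []]//].
    by have [k [Ek _]] := partE t; exists k; rewrite //= mem_index_enum.
  transitivity (P (\big[setU/set0]_(k < K) (Y @^-1` A `&` E k))).
    by rewrite -YAE.
  rewrite measure_bigsetU_ord.
  - by apply: eq_bigr => k _; rewrite m_E; exact: law.
  - by move=> k; exact: measurableI.
  - apply/trivIset_setIl => i j _ _ [t [Ei Ej]].
    by have [k [_ uk]] := partE t; rewrite -(uk _ Ei) -(uk _ Ej).
rewrite ge0_integral_measure_sum//; apply: eq_bigr => k _.
by rewrite m_E ge0_integral_mscale.
Qed.

End mixture.

Section gaussian_mixture.
Context (d : measure_display) (T : measurableType d) (R : realType) (K : nat).
Context (P : probability T R) (Y : T -> R) (E : 'I_K -> set T).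
Context (w m : 'I_K -> R) (v : R).
Hypotheses (mY : measurable_fun setT Y) (mE : forall k, measurable (E k)).
Hypothesis (partE : forall t, exists! k, E k t).
Hypotheses (w0 : forall k, 0 <= w k) (v0 : 0 <= v).
Hypothesis law : forall k A, measurable A ->
  P (Y @^-1` A `&` E k) = ((w k)%:E * normal_law (m k) v A)%E.
Hypothesis mean0 : \sum_(k < K) w k * m k = 0.

Let integral_law (f : R -> R) : measurable_fun setT f -> (forall y, 0 <= f y) ->
  (\int[P]_t (f (Y t))%:E =
   \sum_(k < K) (w k)%:E * \int[normal_law_prob (m k) v]_y (f y)%:E)%E.
Proof.
move=> mf f0.
apply: (@ge0_integral_mixture _ _ _ (measurableTypeR R) _ _ P Y E w
  (fun k => normal_law_prob (m k) v) _ _ _ _ _ (EFin \o f)) => //.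
- by move=> k A mA; rewrite law// normal_law_probE.
- exact/measurable_EFinP.
Qed.

Lemma sum_mixture_weights : \sum_(k < K) w k = 1.
Proof.
apply: EFin_inj; rewrite -sumEFin.
transitivity (\int[P]_t (cst 1%E) t)%E.
  rewrite (@integral_law (cst 1) (measurable_cst _) (fun=> ler01)).
  apply: eq_bigr => k _.
  rewrite [X in (_ * X)%E](_ : _ = 1%E) ?mule1//.
  apply: etrans (integral_cst _ measurableT 1%E) _.
  by rewrite mul1e; exact: probability_setT.
apply: etrans (integral_cst _ measurableT 1%E) _.
by rewrite mul1e; exact: probability_setT.
Qed.

(** The common variance factors out of the moment generating function, and
    Hoeffding's lemma handles the mixture of the means. *)
Lemma subgaussian_mixture (B : R) : (forall k, m k ^+ 2 <= B) ->
  subgaussian P Y (Num.sqrt (v + B)).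
Proof.
move=> mB l; rewrite /mmt_gen_fun unlock.
have -> : (\int[P]_t ((expR \o l \o* Y) t)%:E = \int[P]_t (expR (l * Y t))%:E)%E.
  by apply: eq_integral => t _ /=; rewrite mulrC.
rewrite (@integral_law (fun y => expR (l * y))); last 2 first.
- by apply: measurableT_comp => //; exact: measurable_funM.
- by move=> y; exact: expR_ge0.
under eq_bigr do rewrite integral_normal_law_expR// -EFinM expRD mulrA.
rewrite sumEFin lee_fin -mulr_suml.
have vB : 0 <= v + B by rewrite addr_ge0// (sqr_bound_ge0 sum_mixture_weights mB).
rewrite sqr_sqrtr//.
have -> : l ^+ 2 * (v + B) / 2 = l ^+ 2 * B / 2 + l ^+ 2 * v / 2 by field.
rewrite expRD ler_wpM2r ?expR_ge0//.
exact: hoeffding_mgf w0 sum_mixture_weights mean0 mB.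
Qed.

Let Y_subgaussian : subgaussian P Y (Num.sqrt (v + \sum_(k < K) m k ^+ 2)).
Proof.
apply: subgaussian_mixture => k.
by rewrite (bigD1 k)//= lerDl sumr_ge0// => i _; exact: sqr_ge0.
Qed.

Lemma mixture_Lfun2 : Y \in Lfun P 2%:E.
Proof. exact: subgaussian_Lfun2 mY Y_subgaussian. Qed.

Lemma mixture_variance :
  variance P Y = (\sum_(k < K) w k * (m k ^+ 2 + v))%:E.
Proof.
rewrite varianceE ?mixture_Lfun2// (subgaussian_expectation0 mY Y_subgaussian).
rewrite expe2 mule0 sube0 unlock.
rewrite (@integral_law (fun y => y ^+ 2)); last 2 first.
- exact: measurable_funX.
- by move=> y; exact: sqr_ge0.
under eq_bigr do rewrite integral_normal_law_sqr// -EFinM.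
by rewrite sumEFin.
Qed.

End gaussian_mixture.

(** * Linear forms of a vector that is gaussian within classes *)

Section covariance_matrix.
Context (d : measure_display) (T : measurableType d) (R : realType).
Context (P : probability T R).

Lemma Lfun2_sum (I : Type) (s : seq I) (f : I -> T -> R) :
  (forall i, f i \in Lfun P 2%:E) -> \sum_(i <- s) f i \in Lfun P 2%:E.
Proof.
have [L0 LD] := Lfun_addr_closed P (lee1n 2).
by move=> f2; elim/big_ind : _.
Qed.

Lemma covariance_suml (I : Type) (s : seq I) (f : I -> T -> R) (g : T -> R) :
  (forall i, f i \in Lfun P 2%:E) -> g \in Lfun P 2%:E ->
  covariance P (\sum_(i <- s) f i) g = (\sum_(i <- s) covariance P (f i) g)%E.
Proof.
move=> f2 g2; elim: s => [|i s IHs].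
  by rewrite !big_nil; exact: covariance_cst_l.
by rewrite !big_cons covarianceDl ?IHs// Lfun2_sum.
Qed.

Context (p : nat) (x : T -> p.-tuple R).
Hypothesis x2 : forall j, (fun t => tnth (x t) j) \in Lfun P 2%:E.

Lemma variance_linear_form (a : 'rV[R]_p) :
  variance P (fun t => \sum_(j < p) a 0 j * tnth (x t) j)
  = ((a *m cov_mx P x *m a^T) 0 0)%:E.
Proof.
pose X j t := tnth (x t) j.
have X1 j : X j \in Lfun P 1.
  by apply: Lfun_subset12 (x2 j); exact: fin_num_measure.
have XX1 j l := Lfun2_mul_Lfun1 (x2 j) (x2 l).
have aX2 j : a 0 j \o* X j \in Lfun P 2%:E.
  by apply: (Lfun_scale _ _ (x2 j)); rewrite ler1n.
have aX1 j : a 0 j \o* X j \in Lfun P 1 by rewrite Lfun_scale.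
have -> : (fun t => \sum_(j < p) a 0 j * tnth (x t) j) = \sum_(j < p) (a 0 j \o* X j).
  by apply/funext => t; rewrite fct_sumE; apply: eq_bigr => j _; rewrite mulrC.
rewrite /variance covariance_suml ?Lfun2_sum// mxE -sumEFin.
rewrite (eq_bigr (fun j => \sum_(l < p) (a 0 j * cov_mx P x j l * a 0 l)%:E)%E); last first.
  move=> j _; rewrite covarianceC covariance_suml//; apply: eq_bigr => l _.
  have XaX1 := Lfun2_mul_Lfun1 (x2 j) (aX2 l).
  rewrite covarianceC covarianceZl// covarianceZr; [|exact: X1..|exact: XX1].
  rewrite (_ : cov_mx P x j l = fine (covariance P (X j) (X l))) ?mxE//.
  rewrite !EFinM fineK ?muleA 1?muleAC//.
  by apply: covariance_fin_num; [exact: X1..|exact: XX1].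
rewrite exchange_big/=; apply: eq_bigr => l _.
by rewrite mxE [a^T l 0]mxE mulr_suml -sumEFin.
Qed.
End covariance_matrix.

Section gaussian_classes.
Context (d : measure_display) (T : measurableType d) (R : realType) (K p : nat).
Context (P : probability T R) (x : T -> p.-tuple R) (E : 'I_K -> set T).
Context (w : 'I_K -> R) (mu : 'I_K -> 'rV[R]_p) (S : 'M[R]_p).
Hypotheses (mx : measurable_fun setT x) (mE : forall k, measurable (E k)).
Hypothesis (partE : forall t, exists! k, E k t).
Hypotheses (w0 : forall k, 0 < w k) (PE : forall k, P (E k) = (w k)%:E).
Hypothesis psdS : psd_mx S.
Hypothesis law : forall k, is_multinormal (cond_distribution P x (E k)) (mu k) S.
Hypothesis mean0 : \sum_(k < K) w k *: mu k = 0.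

Section linear_form.
Variable a : 'rV[R]_p.
Let Y t := \sum_(j < p) a 0 j * tnth (x t) j.
Let m k := \sum_(j < p) a 0 j * mu k 0 j.
Let v := (a *m S *m a^T) 0 0.

Let mY : measurable_fun setT Y.
Proof.
apply: measurable_sum => j; apply: measurable_funM => //.
exact: measurableT_comp (measurable_tnth j) mx.
Qed.

Let v0 : 0 <= v.
Proof. exact: (psdS.2 a). Qed.

Let Y_law k (A : set R) : measurable A ->
  P (Y @^-1` A `&` E k) = ((w k)%:E * normal_law (m k) v A)%E.
Proof.
move=> mA; case: (law k) => _ /(_ a A mA) <-.
rewrite /cond_distribution /cond_prob PE inver gt_eqF//.
by rewrite muleCA -EFinM divff ?gt_eqF// mule1.
Qed.

Let m_mean0 : \sum_(k < K) w k * m k = 0.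
Proof.
under eq_bigr do rewrite mulr_sumr.
rewrite exchange_big/= big1// => j _.
under eq_bigr do rewrite mulrCA.
rewrite -mulr_sumr; have := congr1 (fun M : 'rV_p => M 0 j) mean0.
by rewrite summxE mxE; under eq_bigr do rewrite mxE; move=> ->; rewrite mulr0.
Qed.

Let w_ge0 k : 0 <= w k. Proof. exact: ltW. Qed.

Lemma subgaussian_linear_form (B : R) : (forall k, m k ^+ 2 <= B) ->
  subgaussian P Y (Num.sqrt (v + B)).
Proof. exact: (subgaussian_mixture mY mE partE w_ge0 v0 Y_law m_mean0). Qed.

Lemma linear_form_Lfun2 : Y \in Lfun P 2%:E.
Proof. exact: (mixture_Lfun2 mY mE partE w_ge0 v0 Y_law m_mean0). Qed.

Lemma linear_form_variance :
  variance P Y = (\sum_(k < K) w k * (m k ^+ 2 + v))%:E.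
Proof. exact: (mixture_variance mY mE partE w_ge0 v0 Y_law m_mean0). Qed.

End linear_form.

Let Y_delta j : (fun t => \sum_(l < p) (delta_mx 0 j : 'rV[R]_p) 0 l * tnth (x t) l)
  = (fun t => tnth (x t) j).
Proof.
apply/funext => t; rewrite (bigD1 j)//= mxE !eqxx mul1r big1 ?addr0// => l lj.
by rewrite mxE (negbTE lj) andbF mul0r.
Qed.

Lemma coordinate_Lfun2 j : (fun t => tnth (x t) j) \in Lfun P 2%:E.
Proof. by rewrite -Y_delta; exact: linear_form_Lfun2. Qed.

Lemma subgaussian_coordinate (B : R) j : (forall k, mu k 0 j ^+ 2 <= B) ->
  subgaussian P (fun t => tnth (x t) j) (Num.sqrt (S j j + B)).
Proof.
move=> muB; rewrite -Y_delta.
have -> : S j j = ((delta_mx 0 j : 'rV[R]_p) *m S *m (delta_mx 0 j : 'rV[R]_p)^T) 0 0.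
  by rewrite -rowE trmx_delta -colE !mxE.
apply: subgaussian_linear_form => k.
rewrite (_ : \sum_(l < p) _ = mu k 0 j)//.
rewrite (bigD1 j)//= mxE !eqxx mul1r big1 ?addr0// => l lj.
by rewrite mxE (negbTE lj) andbF mul0r.
Qed.

(** Law of total variance: the two sides compute the variance of the linear form
    from the covariance matrix of [x] and from the class laws. *)
Lemma total_variance (a : 'rV[R]_p) :
  (a *m cov_mx P x *m a^T) 0 0 =
  \sum_(k < K) w k * ((\sum_(j < p) a 0 j * mu k 0 j) ^+ 2 + (a *m S *m a^T) 0 0).
Proof.
apply: EFin_inj; rewrite -linear_form_variance variance_linear_form//.
exact: coordinate_Lfun2.
Qed.

End gaussian_classes.

(** * The data matrix *)

Lemma measurable_in_class (d : measure_display) (T : measurableType d) (K : nat)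
    (z : T -> K.-tuple bool) (k : 'I_K) :
  measurable_fun setT z -> measurable (in_class z k).
Proof.
move=> mz; rewrite /in_class -[X in measurable X]setTI.
have mzk : measurable_fun setT (fun w => tnth (z w) k).
  exact: measurableT_comp (measurable_tnth k) mz.
by apply: (mzk measurableT [set true]).
Qed.

Theorem lemma3 (R : realType) (K : nat) (pi_min pi_max : R)
    (hK : (2 <= K)%N) (hmin : 0 < pi_min) (hmax : pi_max < 1) :
  exists C : R, 0 < C /\
  forall (n p : nat)
    (d : measure_display) (T : measurableType d) (P : probability T R)
    (x : 'I_n -> {RV P >-> p.-tuple R})
    (z : 'I_n -> {RV P >-> K.-tuple bool})
    (prior : 'I_K -> R) (mu : 'I_K -> 'rV[R]_p) (Sigma_W Sigma_T : 'M[R]_p),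
    (forall (i : 'I_n) (w : T), exists! k : 'I_K, in_class (z i) k w) ->
    mutually_independent P (fun (i : 'I_n) (w : T) => (x i w, z i w)) ->
    identically_distributed P (fun (i : 'I_n) (w : T) => (x i w, z i w)) ->
    (forall (i : 'I_n) (k : 'I_K), P (in_class (z i) k) = (prior k)%:E) ->
    (forall k : 'I_K, pi_min <= prior k <= pi_max) ->
    (forall (i : 'I_n) (k : 'I_K),
       is_multinormal (cond_distribution P (x i) (in_class (z i) k))
         (mu k) Sigma_W) ->
    \sum_(k < K) prior k *: mu k = 0 ->
    (forall i : 'I_n, cov_mx P (x i) = Sigma_T) ->
    (forall (i : 'I_n) (j : 'I_p),
       subgaussian P (fun w => data_mx x w i j)
         (\big[Num.max/0]_(j' < p)
            Num.sqrt (Sigma_W j' j'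
                      + \big[Num.max/0]_(k < K) (mu k 0 j') ^+ 2)))
    /\
    (forall S : 'M[R]_p, is_inv_sqrtmx Sigma_T S ->
       forall (i : 'I_n) (j : 'I_p),
         subgaussian P (fun w => (data_mx x w *m S) i j) C).
Proof.
have Cmin0 : 0 <= pi_min^-1 by rewrite invr_ge0 ltW.
exists (Num.sqrt pi_min^-1); split; first by rewrite sqrtr_gt0 invr_gt0.
move=> n p d T P x z prior mu S_W S_T hclass _ _ hprior hpi hnormal hmean hcov.
have mx i := @measurable_funPT _ _ _ _ (x i).
have mE i k : measurable (in_class (z i) k) by exact: measurable_in_class.
have prior0 k : 0 < prior k by have /andP[+ _] := hpi k; exact: lt_le_trans.
(* A class exists because K >= 2; any class law carries the hypothesis that
   Sigma_W is positive semidefinite. *)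
have psdW (i : 'I_n) : psd_mx S_W.
  by case: (hnormal i (Ordinal (ltnW hK))).
split.
  move=> i j; pose B j' := \big[Num.max/0]_(k < K) (mu k 0 j') ^+ 2.
  have muB k : mu k 0 j ^+ 2 <= B j by exact: le_bigmax.
  have := subgaussian_coordinate (mx i) (mE i) (hclass i) prior0 (hprior i)
    (psdW i) (hnormal i) hmean muB.
  rewrite (_ : (fun w => data_mx x w i j) = (fun w => tnth (x i w) j)); last first.
    by apply/funext => w; rewrite mxE.
  apply: subgaussian_le; rewrite sqrtr_ge0/=.
  exact: (le_bigmax 0 (fun j' => Num.sqrt (S_W j' j' + B j')) j).
move=> S [unitT [symS _] SS] i j; pose a := row j S.
have -> : (fun w => (data_mx x w *m S) i j) =
    (fun w => \sum_(l < p) a 0 l * tnth (x i w) l).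
  apply/funext => w; rewrite mxE; apply: eq_bigr => l _.
  by rewrite !mxE mulrC -[in LHS]symS mxE.
have var1 : (a *m S_T *m a^T) 0 0 = 1.
  have SST : S *m S_T *m S = 1%:M.
    by apply: mulmx1C; rewrite mulmxA SS mulVmx.
  rewrite /a -row_mul tr_row symS.
  transitivity ((S *m S_T *m S) j j).
    by rewrite !mxE; apply: eq_bigr => l _; rewrite !mxE.
  by rewrite SST mxE eqxx.
rewrite -(hcov i) (total_variance (mx i) (mE i) (hclass i) prior0 (hprior i)
  (psdW i) (hnormal i) hmean) in var1.
(* One term of the total variance is at most the whole sum, which is 1. *)
set v := (a *m S_W *m a^T) 0 0 in var1.
have v0 : 0 <= v by exact: (psdW i).2.
have mB k : (\sum_(l < p) a 0 l * mu k 0 l) ^+ 2 <= pi_min^-1 - v.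
  set m2 := _ ^+ 2; have m20 : 0 <= m2 by exact: sqr_ge0.
  rewrite lerBrDr -[leRHS]mul1r ler_pdivlMr// -var1 (bigD1 k)//= -/m2.
  apply: ler_wpDr.
    by apply: sumr_ge0 => l _; rewrite mulr_ge0 ?(ltW (prior0 l))// addr_ge0 ?sqr_ge0.
  by rewrite mulrC ler_wpM2r ?addr_ge0//; case/andP: (hpi k).
have := subgaussian_linear_form (mx i) (mE i) (hclass i) prior0 (hprior i)
  (psdW i) (hnormal i) hmean mB.
by rewrite -/v subrKC.
Qed.
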